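(* For every real $\xi>0$ there exists $n_0$ such that for every integer $n\ge n_0$ the following holds: let $G$ be a bipartite graph with bipartition $\{V_1,V_2\}$, $|V_1|=|V_2|=N=(2+8\xi)n$, and minimum degree $\delta(G)>\left(\frac78+9\xi\right)N$. Then every $2$-edge coloring of $G$ contains a monochromatic copy of $C_{2n}$.
   Context: $C_{2n}$ denotes the cycle of length $2n$, and $\delta(G)$ denotes the minimum degree of $G$. A $2$-edge coloring is an arbitrary assignment of one of two colors to each edge; a monochromatic copy is a (not necessarily induced) subgraph all of whose edges have the same color. *)

(* Defs.v *)
From HB Require Import structures.
From mathcomp Require Import all_boot all_order all_algebra.
From mathcomp Require Import reals.

Set Implicit Arguments.
Unset Strict Implicit.
Unset Printing Implicit Defensive.

Record sgraph := SGraph {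
  vertex :> finType;
  adj : rel vertex;
  adj_sym : symmetric adj;
  adj_irrefl : irreflexive adj
}.

Definition degree (G : sgraph) (x : G) : nat := #|[set y | adj x y]|.

(* Every degree is at most #|G|, so the default value #|G| of the iterated
   minimum only matters for the graph without vertices. *)
Definition min_degree (G : sgraph) : nat :=
  \big[minn/#|G|]_(x : G) degree x.

Definition independent (G : sgraph) (A : {set G}) : Prop :=
  forall x y : G, x \in A -> y \in A -> ~~ adj x y.

Definition bipartition (G : sgraph) (V1 V2 : {set G}) : Prop :=
  [/\ V1 :|: V2 = [set: G], [disjoint V1 & V2],
      independent V1 & independent V2].

Section CycleGraph.
Variable k : nat.

(* [ordS] is the successor modulo k.  This is the cycle of length k for
   k >= 3; for k <= 2 the conjunct i != j only keeps the relation irreflexive. *)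
Definition cycle_adj : rel 'I_k :=
  fun i j => (i != j) && ((j == ordS i) || (i == ordS j)).

Lemma cycle_adj_sym : symmetric cycle_adj.
Proof. by move=> i j; rewrite /cycle_adj eq_sym orbC. Qed.

Lemma cycle_adj_irrefl : irreflexive cycle_adj.
Proof. by move=> i; rewrite /cycle_adj eqxx. Qed.

Definition cycle_graph : sgraph := SGraph cycle_adj_sym cycle_adj_irrefl.

End CycleGraph.

(* The edge between x and y is the unordered pair [set x; y]; the values of a
   colouring on sets that are not edges of G are never used. *)
Definition two_edge_coloring (G : sgraph) : Type := {set G} -> bool.

Definition has_mono_copy (H G : sgraph) (c : two_edge_coloring G) : Prop :=
  exists (f : H -> G) (color : bool),
    injective f /\
    forall u v : H, adj u v -> adj (f u) (f v) /\ c [set f u; f v] = color.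

(* Main.v *)
Require Import Defs.
From HB Require Import structures.
From mathcomp Require Import all_boot all_order all_algebra.
From mathcomp Require Import reals.
From mathcomp Require Import zify ring lra.
Import Order.TTheory GRing.Theory Num.Theory.

Set Implicit Arguments.
Unset Strict Implicit.
Unset Printing Implicit Defensive.

(** The proof is the connected-matching method.  Partition the vertices into
    boundedly many cells so that almost every edge of G lies, in its own
    colour, in a dense pair of cells: any two large subsets of the cells span
    a positive proportion of edges.  (Only this lower half of regularity is
    needed, and counting the vertex pairs in already discarded sparse cell
    pairs replaces the usual energy.)  After deletion of few vertices, call x
    and y adjacent in a colour if their cells form a dense pair of that colour.
    Every vertex then misses fewer than 1/5 of the other side.

    In such a two-coloured bipartite graph, some monochromatic component C has
    at least as many vertices as one side of the graph.  If C has no matching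
    covering half of each side, delete a small vertex cover of C (König): all
    remaining edges touching C have the other colour, are connected in it, and
    themselves have no small vertex cover.  So one colour has a connected
    matching of size at least n.  A bounded closed walk of cells through the
    matching is lengthened to exactly 2n steps by detours along matching edges,
    and dense pairs allow a greedy embedding of a cycle of G along it; at each
    cell a reserved part is kept for closing the cycle. *)

(** * König's theorem *)

Definition edge_cover (T1 T2 : finType) (E : {set T1 * T2}) (S : {set T1}) (T : {set T2}) :=
  forall p, p \in E -> (p.1 \in S) || (p.2 \in T).

Definition matching (T1 T2 : finType) (M : {set T1 * T2}) :=
  {in M &, injective fst} /\ {in M &, injective snd}.

(* Two edges at x, each critical for the cover number: from covers (S1, T1)
   and (S2, T2) of what is left after deleting one of them, the pairs
   (S1 :&: S2, T1 :|: T2) and (x |: (S1 :|: S2), T1 :&: T2) are covers of all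
   edges, of total size too small. *)
Lemma cover_uncrossing (T1 T2 : finType) (E : {set T1 * T2}) (k : nat) x y z
    (S1 S2 : {set T1}) (U1 U2 : {set T2}) :
  (forall S T, edge_cover E S T -> k <= #|S| + #|T|) ->
  (x, y) \in E -> (x, z) \in E -> y != z ->
  edge_cover (E :\ (x, y)) S1 U1 -> edge_cover (E :\ (x, z)) S2 U2 ->
  #|S1| + #|U1| < k -> #|S2| + #|U2| < k -> False.
Proof.
move=> cov Ey Ez yz c1 c2 l1 l2.
have xS1 : x \notin S1.
  apply/negP=> xS; suff /cov : edge_cover E S1 U1 by lia.
  move=> p pE; have [->|np] := eqVneq p (x, y); first by rewrite xS.
  by apply: c1; rewrite !inE np.
have xS2 : x \notin S2.
  apply/negP=> xS; suff /cov : edge_cover E S2 U2 by lia.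
  move=> p pE; have [->|np] := eqVneq p (x, z); first by rewrite xS.
  by apply: c2; rewrite !inE np.
have zU1 : z \in U1.
  have := c1 (x, z); rewrite !inE Ez xpair_eqE eqxx eq_sym yz (negbTE xS1) /=.
  exact.
have yU2 : y \in U2.
  have := c2 (x, y); rewrite !inE Ey xpair_eqE eqxx yz (negbTE xS2) /=.
  exact.
have /cov k1 : edge_cover E (S1 :&: S2) (U1 :|: U2).
  move=> p pE; rewrite !inE.
  have [->|ny] := eqVneq p (x, y); first by rewrite yU2 !orbT.
  have [->|nz] := eqVneq p (x, z); first by rewrite zU1 !orbT.
  have := c1 p; have := c2 p; rewrite !inE ny nz pE => /(_ isT) + /(_ isT).
  by do 4 case: (_ \in _).
have /cov k2 : edge_cover E (x |: (S1 :|: S2)) (U1 :&: U2).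
  move=> p pE; rewrite !inE.
  have [->|ny] := eqVneq p (x, y); first by rewrite eqxx.
  have [->|nz] := eqVneq p (x, z); first by rewrite eqxx.
  have := c1 p; have := c2 p; rewrite !inE ny nz pE => /(_ isT) + /(_ isT).
  by do 4 case: (_ \in _); rewrite ?orbT.
have := cardsUI S1 S2; have := cardsUI U1 U2.
have := cardsU1 x (S1 :|: S2); case: (_ \notin _) => /=; lia.
Qed.

Definition swap_set (T1 T2 : finType) (E : {set T1 * T2}) : {set T2 * T1} :=
  [set p | (p.2, p.1) \in E].

Lemma cover_swap (T1 T2 : finType) (E : {set T1 * T2}) S T :
  edge_cover (swap_set E) T S <-> edge_cover E S T.
Proof.
split=> c [u v] uv; last by rewrite orbC; apply: (c (v, u)); rewrite inE in uv.
by rewrite orbC; apply: (c (v, u)); rewrite inE.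
Qed.

(** Induction on the number of edges: an edge is deleted while every cover of the rest still has at
    least [k] vertices. Once no edge can be deleted, all are critical, so by uncrossing no two share
    an endpoint and [E] itself is a matching. *)
Lemma konig (T1 T2 : finType) (E : {set T1 * T2}) (k : nat) :
  (forall S T, edge_cover E S T -> k <= #|S| + #|T|) ->
  exists M : {set T1 * T2}, [/\ M \subset E, matching M & k <= #|M|].
Proof.
have [m] := ubnP #|E|; elim: m E => // m IH E ltm cov.
have [/existsP[e /andP[eE /forallP He]]|] := boolP [exists e, (e \in E) &&
    [forall S : {set T1}, forall T : {set T2},
      [forall p in E :\ e, (p.1 \in S) || (p.2 \in T)] ==> (k <= #|S| + #|T|)]].
  have [||M [ME mM kM]] := IH (E :\ e).
  - by move: ltm; rewrite (cardsD1 e) eE; lia.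
  - move=> S T c; have /forallP/(_ T)/implyP := He S; apply.
    by apply/forall_inP=> p; apply: c.
  by exists M; split=> //; apply: subset_trans ME (subsetDl _ _).
rewrite negb_exists => /forallP crit.
have critP e : e \in E -> exists S T, edge_cover (E :\ e) S T /\ #|S| + #|T| < k.
  move=> eE; have := crit e; rewrite eE /= negb_forall => /existsP[S].
  rewrite negb_forall => /existsP[T]; rewrite negb_imply -ltnNge.
  move=> /andP[/forall_inP c l]; exists S, T; split=> //.
exists E; have i1 : {in E &, injective fst}.
  move=> [x y] [x' z] e1 e2 /= exx; rewrite -exx in e2 *.
  apply/eqP; case: eqVneq => // ne.
  have yz : y != z by apply: contraNneq ne => ->.
  have [S1 [U1 [c1 l1]]] := critP _ e1; have [S2 [U2 [c2 l2]]] := critP _ e2.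
  by have := cover_uncrossing cov e1 e2 yz c1 c2 l1 l2.
have i2 : {in E &, injective snd}.
  move=> [y x] [z x'] e1 e2 /= exx; rewrite -exx in e2 *.
  apply/eqP; case: eqVneq => // ne.
  have yz : y != z by apply: contraNneq ne => ->.
  have [S1 [U1 [c1 l1]]] := critP _ e1; have [S2 [U2 [c2 l2]]] := critP _ e2.
  have swD u : swap_set (E :\ (u, x)) = swap_set E :\ (x, u).
    by apply/setP=> -[v w]; rewrite !inE !xpair_eqE andbC [RHS]andbC (andbC (v == _)).
  move/cover_swap: c1; move/cover_swap: c2; rewrite !swD => c2 c1.
  have covs S T : edge_cover (swap_set E) S T -> k <= #|S| + #|T|.
    by move/cover_swap/cov; rewrite addnC.
  by rewrite addnC in l1; rewrite addnC in l2;
     have := @cover_uncrossing _ _ (swap_set E) k x y z _ _ _ _ covs;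
     rewrite !inE => /(_ _ _ _ _ e1 e2 yz c1 c2 l1 l2).
split=> //.
(* The first endpoints cover [E], and by injectivity there are exactly [#|E|] of them. *)
have /cov : edge_cover E (fst @: E) set0.
  by move=> p pE; rewrite imset_f.
by rewrite cards0 addn0 card_in_imset.
Qed.

(** * A one-sided regularity lemma *)

Definition edges_between (V : finType) (e : rel V) (X Y : {set V}) : nat :=
  #|[set p in setX X Y | e p.1 p.2]|.

Definition large_in (V : finType) (a : nat) (A X : {set V}) :=
  (X \subset A) && (#|A| <= a * #|X|).

(* The lower half of regularity, with parameters 1/a (size of the subsets) and
   1/b (density between them). *)
Definition dense_pair (V : finType) (a b : nat) (e : rel V) (A B : {set V}) :=
  [forall X : {set V}, forall Y : {set V}, large_in a A X ==> large_in a B Y ==>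
    (#|X| * #|Y| <= b * edges_between e X Y)].

Definition cell (V L : finType) (f : V -> L) (i : L) : {set V} := [set v | f v == i].

Lemma card_fibers (T I : finType) (lab : T -> I) (D : {set T}) :
  #|D| = \sum_i #|[set p in D | lab p == i]|.
Proof.
rewrite -sum1_card (partition_big lab predT) //=.
by apply: eq_bigr => i _; rewrite -sum1dep_card.
Qed.

Lemma leq_card_fibers (T I : finType) (lab : T -> I) (A B : {set T}) m n :
  (forall i, m * #|[set p in A | lab p == i]| <= n * #|[set p in B | lab p == i]|) ->
  m * #|A| <= n * #|B|.
Proof.
rewrite (card_fibers lab A) (card_fibers lab B) !big_distrr /= => le.
by apply: leq_sum => i _; apply: le.
Qed.

Lemma card_slice (T C : finType) (c : C) (D : {set T}) :
  #|[set p : T * C | (p.1 \in D) && (p.2 == c)]| = #|D|.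
Proof.
rewrite -[RHS](card_imset D (f := fun q => (q, c))); last by move=> ? ? [].
apply: eq_card => -[q d]; rewrite !inE /=; apply/andP/imsetP => [[Dq /eqP ->]|].
  by exists q.
by case=> q' Dq [-> ->].
Qed.

Lemma card_setsort (T : finType) : #|{set T}| = 2 ^ #|T|.
Proof. by rewrite -(cardsT T) -card_powerset powersetT cardsT. Qed.

Section Regularity.
Variables (C : finType) (a b : nat).

(** Ordered vertex pairs are tagged with a colour, so that one partition and one potential serve all
    colours. *)
Definition cell_triple (V L : finType) (f : V -> L) (p : V * V * C) : L * L * C :=
  (f p.1.1, f p.1.2, p.2).

Definition irregular_edges (V L : finType) (r : C -> rel V) (f : V -> L) : {set V * V * C} :=
  [set p | r p.2 p.1.1 p.1.2 &&
     ~~ dense_pair a b (r p.2) (cell f (f p.1.1)) (cell f (f p.1.2))].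

(** [nul] lists the triples of cells already found sparse. The invariant kept below is that at most
    a fraction [1/b] of the vertex triples they contain are edges. *)
Definition null_triples (V L : finType) (f : V -> L) (nul : {set L * L * C}) :
  {set V * V * C} := [set p | cell_triple f p \in nul].

Definition null_edges (V L : finType) (r : C -> rel V) (f : V -> L) (nul : {set L * L * C}) :
  {set V * V * C} := [set p in null_triples f nul | r p.2 p.1.1 p.1.2].

Lemma holes (V L : finType) (r : C -> rel V) (f : V -> L) (nul : {set L * L * C}) :
  exists (bad : {set L * L * C}) (X Y : L * L * C -> {set V}),
  [/\ forall t, t \in bad = (t \notin nul) &&
        ~~ dense_pair a b (r t.2) (cell f t.1.1) (cell f t.1.2),
      forall t, t \in bad -> large_in a (cell f t.1.1) (X t),
      forall t, t \in bad -> large_in a (cell f t.1.2) (Y t) &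
      forall t, t \in bad -> b * edges_between (r t.2) (X t) (Y t) < #|X t| * #|Y t|].
Proof.
pose bad := [set t : L * L * C | (t \notin nul) &&
        ~~ dense_pair a b (r t.2) (cell f t.1.1) (cell f t.1.2)].
pose ok t (Z : {set V} * {set V}) := [&& large_in a (cell f t.1.1) Z.1,
  large_in a (cell f t.1.2) Z.2 & b * edges_between (r t.2) Z.1 Z.2 < #|Z.1| * #|Z.2|].
pose Z t := odflt (set0, set0) [pick W | ok t W].
have okZ t : t \in bad -> ok t (Z t).
  rewrite inE => /andP[_]; rewrite negb_forall => /existsP[X].
  rewrite negb_forall => /existsP[Y]; rewrite !negb_imply -ltnNge => h.
  by rewrite /Z; case: pickP => // /(_ (X, Y)); rewrite /ok /= h.
exists bad, (fun t => (Z t).1), (fun t => (Z t).2); split=> t.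
- by rewrite inE.
- by move/okZ/and3P=> [].
- by move/okZ/and3P=> [].
- by move/okZ/and3P=> [].
Qed.

(* Both cells of an irregular pair are split along a sparse hole, and the hole
   becomes null: the number of null triples is the increasing potential. *)
Lemma refine_null (V L : finType) (r : C -> rel V) (f : V -> L) (nul : {set L * L * C}) :
  b * #|null_edges r f nul| <= #|null_triples f nul| ->
  let T := #|C| * #|V| ^ 2 in
  b * #|irregular_edges r f| <= 2 * T \/
  exists (L' : finType) (f' : V -> L') (nul' : {set L' * L' * C}),
    [/\ #|L'| = #|L| * 2 ^ (#|L| * #|L| * #|C|) * 2 ^ (#|L| * #|L| * #|C|),
        b * #|null_edges r f' nul'| <= #|null_triples f' nul'| &
        b * a ^ 2 * #|null_triples f nul| + T <= b * a ^ 2 * #|null_triples f' nul'|].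
Proof.
move=> sparse T; have [bad [X [Y [badP lX lY sp]]]] := holes r f nul.
pose Bd := [set p | cell_triple f p \in bad].
have cT (D : {set V * V * C}) : #|D| <= T.
  by rewrite (leq_trans (max_card _)) // !card_prod /T -mulnn mulnC.
(* If the bad triples of cells contain few vertex triples, the partition is already good: every
   irregular edge is a null edge or lies in [Bd]. *)
have [le|gt] := leqP (b * #|Bd|) T; [left|right].
  have sub : irregular_edges r f \subset null_edges r f nul :|: Bd.
    apply/subsetP=> p; rewrite !inE badP /= => /andP[-> ->].
    by rewrite !andbT orbN.
  have := leq_trans (subset_leq_card sub) (leq_card_setU _ _).1.
  move=> /(leq_mul (leqnn b)) /leq_trans; apply; rewrite mulnDr mul2n -addnn.
  by rewrite leq_add // (leq_trans sparse).
(* A new label records the old cell and the membership in every chosen hole, so each hole splits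
   exactly into triples of new cells. *)
pose L' := (L * {set L * L * C} * {set L * L * C})%type.
pose f' v : L' := (f v, [set t | v \in X t], [set t | v \in Y t]).
pose nul' := [set t : L' * L' * C | let u := (t.1.1.1.1, t.1.2.1.1, t.2) in
  (u \in nul) || [&& u \in bad, u \in t.1.1.1.2 & u \in t.1.2.2]].
pose H := [set p | [&& cell_triple f p \in bad, p.1.1 \in X (cell_triple f p)
   & p.1.2 \in Y (cell_triple f p)]].
have HtE t : t \in bad -> [set p in H | cell_triple f p == t] =
    [set p : V * V * C | (p.1 \in setX (X t) (Y t)) && (p.2 == t.2)].
  move=> tb; apply/setP=> -[[x y] c]; rewrite !inE /=.
  case: t tb => -[i j] c' tb; rewrite /cell_triple /= !xpair_eqE.
  have /andP[/subsetP sX _] := lX _ tb; have /andP[/subsetP sY _] := lY _ tb.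
  apply/idP/idP.
    by case/and3P=> /and3P[_ xX yY] /andP[/eqP <- /eqP <-] /eqP <-; rewrite xX yY /=.
  case/andP=> /andP[xX yY] /eqP ->.
  have := sX _ xX; have := sY _ yY; rewrite !inE /= => /eqP -> /eqP ->.
  by rewrite tb xX yY !eqxx.
have nE : null_triples f' nul' = null_triples f nul :|: H.
  by apply/setP=> p; rewrite !inE /= !inE.
have dis : [disjoint null_triples f nul & H].
  rewrite -setI_eq0; apply/eqP; apply/setP=> p; rewrite !inE badP.
  by case: (_ \in nul).
exists L', f', nul'; split.
- by rewrite !card_prod !card_setsort !card_prod.
- have eE : null_edges r f' nul' =
      null_edges r f nul :|: [set p in H | r p.2 p.1.1 p.1.2].
    by rewrite /null_edges nE; apply/setP=> p; rewrite !inE andb_orl.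
  rewrite eE nE (cardsU (null_triples _ _)) (disjoint_setI0 dis) cards0 subn0.
  apply: leq_trans (leq_mul (leqnn b) (leq_card_setU _ _).1) _.
  rewrite mulnDr; apply: leq_add => //; rewrite -[leqRHS]mul1n.
  apply: (leq_card_fibers (lab := cell_triple f)) => t.
  have [tb|tnb] := boolP (t \in bad); last first.
    rewrite (_ : [set p in [set p in H | _] | _] = set0) ?cards0 ?muln0 //.
    apply/setP=> p; rewrite !inE; case: eqP => [->|]; last by rewrite andbF.
    by rewrite (negbTE tnb).
  have HX : [set p in H | cell_triple f p == t] =
      [set p : V * V * C | (p.1 \in setX (X t) (Y t)) && (p.2 == t.2)].
    exact: HtE.
  have eX : [set p in [set p in H | r p.2 p.1.1 p.1.2] | cell_triple f p == t] =
      [set p : V * V * C |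
        (p.1 \in [set q in setX (X t) (Y t) | r t.2 q.1 q.2]) && (p.2 == t.2)].
    apply/setP=> p; have /setP/(_ p) := HX; rewrite !inE /=.
    move=> E; rewrite [LHS]andbAC E.
    by case: eqP => [->|_]; rewrite ?andbT ?andbF.
  rewrite HX eX !card_slice mul1n.
  by rewrite cardsX ltnW ?sp.
(* A hole fills at least a fraction [1/a^2] of its pair of cells, so the gain is at least
   [#|Bd| / a^2]. *)
- rewrite nE cardsU (disjoint_setI0 dis) cards0 subn0 mulnDr leq_add2l.
  apply: (leq_trans (ltnW gt)); rewrite -mulnA leq_mul2l -[#|Bd|]mul1n.
  apply/orP; right; apply: (leq_card_fibers (lab := cell_triple f)) => t.
  have [tb|tnb] := boolP (t \in bad); last first.
    rewrite (_ : [set p in Bd | _] = set0) ?cards0 ?muln0 //.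
    apply/setP=> p; rewrite !inE; case: eqP => [->|]; last by rewrite andbF.
    by rewrite (negbTE tnb).
  have BE : [set p in Bd | cell_triple f p == t] =
      [set p : V * V * C | (p.1 \in setX (cell f t.1.1) (cell f t.1.2)) && (p.2 == t.2)].
    apply/setP=> -[[x y] c]; rewrite !inE /=.
    case: t tb => -[i j] c' tb; rewrite /cell_triple /= !xpair_eqE.
    by apply/andP/idP => [[_ ->//]|E]; split=> //; move: E => /andP[/andP[/eqP-> /eqP->] /eqP ->].
  rewrite (HtE _ tb) BE !card_slice mul1n.
  have /andP[_ l1] := lX _ tb; have /andP[_ l2] := lY _ tb.
  by rewrite !cardsX -mulnn mulnACA leq_mul.
Qed.

(** Each refinement makes a fixed fraction of all triples newly null, so boundedly many rounds
    suffice; this bounds the number of cells independently of [V]. *)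
Lemma regularity : exists M : nat, forall (V : finType) (r : C -> rel V),
  exists (L : finType) (f : V -> L),
    #|L| <= M /\ b * #|irregular_edges r f| <= 2 * (#|C| * #|V| ^ 2).
Proof.
suff st m : exists M : nat, forall (V : finType) (r : C -> rel V),
    (exists (L : finType) (f : V -> L),
      #|L| <= M /\ b * #|irregular_edges r f| <= 2 * (#|C| * #|V| ^ 2)) \/
    exists (L : finType) (f : V -> L) (nul : {set L * L * C}),
      [/\ #|L| <= M, b * #|null_edges r f nul| <= #|null_triples f nul| &
          m * (#|C| * #|V| ^ 2) <= b * a ^ 2 * #|null_triples f nul|].
  (* After this many rounds there would be more null triples than triples, unless there are no
     triples at all; then the bound is trivial. *)
  have [M HM] := st (b * a ^ 2).+1; exists M => V r.
  have cT (D : {set V * V * C}) : #|D| <= #|C| * #|V| ^ 2.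
    by rewrite (leq_trans (max_card _)) // !card_prod -mulnn mulnC.
  have [//|[L [f [nul [lM _ le]]]]] := HM V r.
  exists L, f; split=> //.
  have T0 : #|C| * #|V| ^ 2 = 0.
    have := leq_trans le (leq_mul (leqnn _) (cT _)); nia.
  have := cT (irregular_edges r f); rewrite T0 leqn0 => /eqP ->.
  by rewrite muln0.
elim: m => [|m [M IH]].
  exists 1 => V r; right; exists unit, (fun=> tt), set0.
  by rewrite card_unit (_ : null_edges _ _ _ = set0) ?cards0 ?muln0 //; apply/setP=> p; rewrite !inE.
exists (M * 2 ^ (M * M * #|C|) * 2 ^ (M * M * #|C|)) => V r.
have up k : k <= M -> k * 2 ^ (k * k * #|C|) * 2 ^ (k * k * #|C|) <=
    M * 2 ^ (M * M * #|C|) * 2 ^ (M * M * #|C|).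
  by move=> kM; rewrite !leq_mul ?leq_pexp2l // !leq_mul.
have up' k : k <= M -> k <= M * 2 ^ (M * M * #|C|) * 2 ^ (M * M * #|C|).
  by move=> kM; rewrite -mulnA; apply: leq_trans kM (leq_pmulr _ _); rewrite muln_gt0 !expn_gt0.
have [[L [f [lM le]]]|[L [f [nul [lM sp le]]]]] := IH V r.
  by left; exists L, f; split=> //; apply: up'.
have [le'|[L' [f' [nul' [cL sp' le']]]]] := refine_null sp.
  by left; exists L, f; split=> //; apply: up'.
right; exists L', f', nul'; split=> //; first by rewrite cL up.
by rewrite mulSn addnC; apply: leq_trans le'; rewrite leq_add2r.
Qed.
End Regularity.

(** * Connected monochromatic matchings *)

Lemma konig_dichotomy (T1 T2 : finType) (E : {set T1 * T2}) (k : nat) :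
  (exists M : {set T1 * T2}, [/\ M \subset E, matching M & k <= #|M|]) \/
  (exists S T, edge_cover E S T /\ #|S| + #|T| < k).
Proof.
have [/existsP[S /existsP[T /andP[/forall_inP c l]]]|] :=
    boolP [exists S : {set T1}, exists T : {set T2},
      [forall p in E, (p.1 \in S) || (p.2 \in T)] && (#|S| + #|T| < k)].
  by right; exists S, T.
rewrite negb_exists => /forallP H; left; apply: konig => S T c.
rewrite leqNgt; apply/negP=> l; have := H S; rewrite negb_exists.
by move=> /forallP/(_ T); rewrite l andbT => /forall_inP.
Qed.

Section AlmostComplete.
Variables (V : finType) (s : nat).
Implicit Types (g : rel V) (A B X Y : {set V}).

Definition almost_joined g A B := forall u, u \in A -> #|[set v in B | ~~ g u v]| <= s.

(** Two vertices of [A] together miss at most [2 * s] vertices of [B], so they have a common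
    neighbour. *)
Lemma almost_joined_connect g A B u v : symmetric g ->
  almost_joined g A B -> 2 * s < #|B| -> u \in A -> v \in A -> connect g u v.
Proof.
move=> sg aj lB uA vA.
have [w /andP[gu gv]|no] := pickP (fun w => g u w && g v w).
  by apply: connect_trans (connect1 gu) _; apply: connect1; rewrite sg.
suff : #|B| <= s + s by move: lB; lia.
apply: leq_trans (leq_add (aj _ uA) (aj _ vA)).
apply: leq_trans (leq_card_setU _ _).1; apply: subset_leq_card.
by apply/subsetP=> w wB; rewrite !inE wB -negb_and no.
Qed.

Lemma almost_joined_neighbour g A B w :
  almost_joined g A B -> s < #|B| -> w \in A -> exists2 u, u \in B & g w u.
Proof.
move=> aj lB wA.
have [u /andP[uB gu]|no] := pickP (fun u => (u \in B) && g w u); first by exists u.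
have := aj _ wA; rewrite leqNgt; case/negP; apply: leq_trans lB _.
by apply: subset_leq_card; apply/subsetP=> u uB; have := no u; rewrite !inE uB /= => ->.
Qed.

Variable e : bool -> rel V.
Hypothesis e_sym : forall c, symmetric (e c).

Definition bicolored_joined X Y :=
  almost_joined (fun u v => e true u v || e false u v) X Y.

Definition comp c r : {set V} := [set v | connect (e c) r v].

Lemma other_color X Y A B c : bicolored_joined X Y -> A \subset X -> B \subset Y ->
  (forall u v, u \in A -> v \in B -> ~~ e c u v) -> almost_joined (e (~~ c)) A B.
Proof.
move=> bj /subsetP AX /subsetP BY no u uA.
apply: leq_trans (bj _ (AX _ uA)); apply: subset_leq_card; apply/subsetP=> v.
rewrite !inE => /andP[vB nu]; rewrite BY //=; have := no _ _ uA vB.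
by case: c {no} nu => /= /negbTE -> /negbTE ->.
Qed.

(** No edge of colour [c] leaves the component, so its part of [Y] is almost joined to the rest of
    [X] in the other colour. Common neighbours connect the former set, and each vertex of the latter
    has a neighbour in it. *)
Lemma cross_component X Y c r : bicolored_joined X Y -> bicolored_joined Y X ->
  s < #|Y :&: comp c r| -> 2 * s < #|X :\: comp c r| ->
  exists r', (Y :&: comp c r \subset comp (~~ c) r') /\
             (X :\: comp c r \subset comp (~~ c) r').
Proof.
move=> bXY bYX lY lX.
have no u v : u \in comp c r -> v \notin comp c r -> ~~ e c u v.
  by rewrite !inE => ru; apply: contra => uv; apply: connect_trans ru (connect1 uv).
have aj1 : almost_joined (e (~~ c)) (Y :&: comp c r) (X :\: comp c r).
  apply: (other_color bYX); rewrite ?subsetIl ?subsetDl // => u v.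
  by rewrite inE => /andP[_ uc]; rewrite inE => /andP[vc _]; apply: no.
have aj2 : almost_joined (e (~~ c)) (X :\: comp c r) (Y :&: comp c r).
  apply: (other_color bXY); rewrite ?subsetIl ?subsetDl // => u v.
  by rewrite !(inE, e_sym c u) => /andP[uc _] /andP[_ vc]; apply: no; rewrite inE.
have /card_gt0P[r' r'Y] : 0 < #|Y :&: comp c r| by apply: leq_ltn_trans lY.
exists r'; split; apply/subsetP=> v vA; rewrite inE.
  exact: (almost_joined_connect _ aj1).
have [u uY vu] := almost_joined_neighbour aj2 lY vA.
apply: (@connect_trans _ _ u); first exact: (almost_joined_connect _ aj1).
by apply: connect1; rewrite e_sym.
Qed.

(** If a component is too small, replacing its smaller side by the complement of that side gives at
    least [P] vertices connected in the other colour. The lower bounds [2 * s] serve the final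
    contradiction in [connected_matching]. *)
Lemma large_component X Y P : #|X| = P -> #|Y| = P -> 5 * s < P ->
  bicolored_joined X Y -> bicolored_joined Y X ->
  exists c r, [/\ P <= #|X :&: comp c r| + #|Y :&: comp c r|,
    2 * s <= #|X :&: comp c r| & 2 * s <= #|Y :&: comp c r|].
Proof.
move=> cX cY ls bXY bYX.
have /card_gt0P[x xX] : 0 < #|X| by lia.
have [c lc] : exists c, 2 * s < #|Y :&: comp c x|.
  have : #|Y| <= s + (#|Y :&: comp true x| + #|Y :&: comp false x|).
    apply: leq_trans (leq_add (bXY _ xX) (leq_card_setU _ _).1).
    apply: leq_trans (leq_card_setU _ _).1; apply: subset_leq_card.
    apply/subsetP=> y yY; rewrite !inE yY /=.
    by have [/orP[/connect1 ->|/connect1 ->]|] := boolP (e true x y || e false x y); rewrite ?orbT.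
  by case: (ltnP (2 * s) #|Y :&: comp true x|) => [|l1 l2]; [exists true | exists false; lia].
have cXD := cardsID (comp c x) X; have cYD := cardsID (comp c x) Y.
have [le|gt] := leqP #|X :&: comp c x| #|Y :&: comp c x|.
  have [/andP[l1 l2]|] := boolP ((P <= #|X :&: comp c x| + #|Y :&: comp c x|)
     && (2 * s <= #|X :&: comp c x|)); first by exists c, x; split=> //; lia.
  rewrite negb_and -!ltnNge => small.
  have [||r' [sY sX]] := cross_component bXY bYX (c := c) (r := x); [lia|lia|].
  exists (~~ c), r'.
  have l1 : #|Y :&: comp c x| <= #|Y :&: comp (~~ c) r'|.
    by apply: subset_leq_card; rewrite subsetI subsetIl.
  have l2 : #|X :\: comp c x| <= #|X :&: comp (~~ c) r'|.
    by apply: subset_leq_card; rewrite subsetI subsetDl.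
  by split; lia.
have [le|small] := leqP P (#|X :&: comp c x| + #|Y :&: comp c x|).
  by exists c, x; split=> //; lia.
have [||r' [sX sY]] := cross_component bYX bXY (c := c) (r := x); [lia|lia|].
exists (~~ c), r'.
have l1 : #|X :&: comp c x| <= #|X :&: comp (~~ c) r'|.
  by apply: subset_leq_card; rewrite subsetI subsetIl.
have l2 : #|Y :\: comp c x| <= #|Y :&: comp (~~ c) r'|.
  by apply: subset_leq_card; rewrite subsetI subsetDl.
by split; lia.
Qed.

Lemma connected_matching X Y P : #|X| = P -> #|Y| = P -> 5 * s < P ->
  bicolored_joined X Y -> bicolored_joined Y X ->
  exists c (M : {set V * V}), [/\ matching M,
    forall p, p \in M -> [&& p.1 \in X, p.2 \in Y & e c p.1 p.2],
    P <= 2 * #|M| &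
    forall p q, p \in M -> q \in M -> connect (e c) p.1 q.1].
Proof.
move=> cX cY ls bXY bYX.
have [c [r [lXY lX lY]]] := large_component cX cY ls bXY bYX.
set X1 := X :&: comp c r in lXY lX; set Y1 := Y :&: comp c r in lXY lY.
(* Half of [P] rounded up: two covers smaller than [k] have fewer than [P] vertices together and
   cannot exhaust the component. *)
pose k := P - P %/ 2.
have [[M [ME mM kM]]|[S [T [cov1 l1]]]] :=
    konig_dichotomy [set p in setX X1 Y1 | e c p.1 p.2] k.
  exists c, M; split=> //.
  - by move=> p /(subsetP ME); rewrite !inE => /andP[/andP[/andP[-> _] /andP[-> _]] ->].
  - lia.
  - move=> p q /(subsetP ME) + /(subsetP ME); rewrite !inE.
    move=> /andP[/andP[/andP[_ rp] _] _] /andP[/andP[/andP[_ rq] _] _].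
    by apply: connect_trans rq; rewrite (sym_connect_sym (e_sym c)).
(* What the cover leaves of the component. Edges between uncovered vertices that touch it have only
   the other colour, and that colour connects [W]. *)
pose W := (X1 :\: S) :|: (Y1 :\: T).
have noc u v : u \in X :\: S -> v \in Y :\: T -> (u \in X1) || (v \in Y1) -> ~~ e c u v.
  rewrite !inE => /andP[uS uX] /andP[vT vY]; rewrite uX vY /= => H; apply/negP=> uv.
  have /andP[ru rv] : connect (e c) r u && connect (e c) r v.
    case/orP: H => H; rewrite H ?andbT /=; apply: connect_trans H _.
      exact: connect1.
    by apply: connect1; rewrite e_sym.
  by have := cov1 (u, v); rewrite !inE uX vY ru rv uv (negbTE uS) (negbTE vT) => /(_ isT).
have aX : almost_joined (e (~~ c)) (X1 :\: S) (Y :\: T).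
  apply: (other_color bXY); rewrite ?subsetDl //.
    by apply: subset_trans (subsetDl _ _) (subsetIl _ _).
  move=> u v /setDP[u1 uS] v1; apply: noc => //; last by rewrite u1.
  by rewrite inE uS; case/setIP: u1.
have aY : almost_joined (e (~~ c)) (Y1 :\: T) (X :\: S).
  apply: (other_color bYX); rewrite ?subsetDl //.
    by apply: subset_trans (subsetDl _ _) (subsetIl _ _).
  move=> v u /setDP[v1 vT] u1; rewrite e_sym; apply: noc => //; last by rewrite v1 orbT.
  by rewrite inE vT; case/setIP: v1.
have aXY : almost_joined (e (~~ c)) (X1 :\: S) (Y1 :\: T).
  move=> u /aX; apply: leq_trans; apply: subset_leq_card; apply/subsetP=> v.
  by rewrite !inE => /andP[/andP[-> /andP[-> _]] ->].
have aYX : almost_joined (e (~~ c)) (Y1 :\: T) (X1 :\: S).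
  move=> u /aY; apply: leq_trans; apply: subset_leq_card; apply/subsetP=> v.
  by rewrite !inE => /andP[/andP[-> /andP[-> _]] ->].
have cD (A B : {set V}) : #|A| <= #|B| + #|A :\: B|.
  by rewrite -(cardsID B A) leq_add2r subset_leq_card ?subsetIr.
have lXS := cD X S; have lYT := cD Y T; have lX1S := cD X1 S; have lY1T := cD Y1 T.
have symc : symmetric (connect (e (~~ c))) := sym_connect_sym (e_sym _).
(* At least one side of [W] has more than [s] vertices, enough to provide an edge joining the two
   sides. *)
have connXY u v : u \in X1 :\: S -> v \in Y1 :\: T -> connect (e (~~ c)) u v.
  move=> uX vY; have [l|l] := ltnP s #|X1 :\: S|.
    have [w wX vw] := almost_joined_neighbour aYX l vY.
    apply: (@connect_trans _ _ w); first by apply: (almost_joined_connect _ aX) => //; lia.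
    by rewrite symc connect1.
  have [|w wX vw] := almost_joined_neighbour aXY _ uX; first by lia.
  apply: (connect_trans (connect1 vw)).
  by apply: (almost_joined_connect _ aY) => //; lia.
have connW u v : u \in W -> v \in W -> connect (e (~~ c)) u v.
  rewrite !in_setU => /orP[uX|uY] /orP[vX|vY].
  - by apply: (almost_joined_connect _ aX) => //; lia.
  - exact: connXY.
  - by rewrite symc; apply: connXY.
  - by apply: (almost_joined_connect _ aY) => //; lia.
pose E2 := [set p in setX (X :\: S) (Y :\: T) |
  ((p.1 \in X1) || (p.2 \in Y1)) && e (~~ c) p.1 p.2].
have [[M [ME mM kM]]|[S' [T' [cov2 l2]]]] := konig_dichotomy E2 k.
  exists (~~ c), M; split=> //.
  - move=> p /(subsetP ME); rewrite !inE.
    by move=> /andP[/andP[/andP[_ ->] /andP[_ ->]] /andP[_ ->]].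
  - lia.
  - have toW p : p \in M -> exists2 w, w \in W & connect (e (~~ c)) p.1 w.
      move=> /(subsetP ME); rewrite 3!inE => /andP[/andP[pX pY] /andP[/orP[p1|p2] pe]].
        exists p.1 => //; rewrite in_setU in_setD p1 andbT.
        by move: pX; rewrite inE => /andP[->].
      exists p.2; last exact: connect1.
      rewrite in_setU !in_setD p2 andbT orbC.
      by move: pY; rewrite inE => /andP[->].
    move=> p q /toW[w wW pw] /toW[w' wW' qw].
    apply: connect_trans pw _; apply: (connect_trans (connW _ _ wW wW')).
    by rewrite symc.
(* Some vertex of the component avoids both covers. It sees no uncovered vertex opposite, so at most
   [s] are uncovered there, and fewer than [s] are covered on its own side. Of the at least [2 * s]
   component vertices on that side more than [s] remain, all missed by a single uncovered opposite
   vertex. *)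
exfalso; pose A := S :|: S'; pose B := T :|: T'.
have lA := (leq_card_setU S S').1; have lB := (leq_card_setU T T').1.
have lAB : #|A| + #|B| < P by rewrite /A /B; lia.
have miss u v : u \in X :\: A -> v \in Y :\: B -> (u \in X1) || (v \in Y1) ->
    ~~ (e true u v || e false u v).
  rewrite !in_setD !in_setU !negb_or => /andP[/andP[uS uS'] uX] /andP[/andP[vT vT'] vY] H.
  have /negbTE n1 : ~~ e c u v by apply: noc; rewrite // in_setD ?uS ?vT.
  have /negbTE n2 : ~~ e (~~ c) u v.
    apply/negP=> uv; have := cov2 (u, v); rewrite 3!inE /= uv H !in_setD uS uX vT vY.
    by rewrite (negbTE uS') (negbTE vT') => /(_ isT).
  by case: (c) n1 n2 => -> ->.
have lXA := cD X A; have lYB := cD Y B.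
have missX u (Q : {set V}) : u \in X -> Q \subset Y ->
    (forall v, v \in Q -> ~~ (e true u v || e false u v)) -> #|Q| <= s.
  move=> uX /subsetP QY H; apply: leq_trans (bXY _ uX); apply: subset_leq_card.
  by apply/subsetP=> v vQ; rewrite inE QY ?H.
have missY v (Q : {set V}) : v \in Y -> Q \subset X ->
    (forall u, u \in Q -> ~~ (e true u v || e false u v)) -> #|Q| <= s.
  move=> vY /subsetP QX H; apply: leq_trans (bYX _ vY); apply: subset_leq_card.
  by apply/subsetP=> u uQ; rewrite inE QX ?(e_sym _ v) ?H.
have subX : X1 :\: A \subset X :\: A by rewrite setSD ?subsetIl.
have subY : Y1 :\: B \subset Y :\: B by rewrite setSD ?subsetIl.
have lX1A := cD X1 A; have lY1B := cD Y1 B.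
have cXA : #|X :\: A| <= P by rewrite -cX subset_leq_card ?subsetDl.
have cYB : #|Y :\: B| <= P by rewrite -cY subset_leq_card ?subsetDl.
have [X0|[u uX1]] := set_0Vmem (X1 :\: A).
  have [Y0|[v vY1]] := set_0Vmem (Y1 :\: B).
    by move: lX1A lY1B; rewrite X0 Y0 cards0; lia.
  have vB := subsetP subY _ vY1; have vY := subsetP (subsetDl _ _) _ vB.
  have vin : v \in Y1 by case/setDP: vY1.
  have small : #|X :\: A| <= s.
    by apply: (missY v) => // [|u uA]; rewrite ?subsetDl // miss ?vin ?orbT.
  have /card_gt0P[u uA] : 0 < #|X :\: A| by lia.
  have uX := subsetP (subsetDl _ _) _ uA.
  have lY1 : #|Y1 :\: B| <= s.
    apply: (missX u) => // [|w wY1].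
      by apply: subset_trans subY (subsetDl _ _).
    apply: miss => //; first exact: (subsetP subY).
    by case/setDP: wY1 => ->; rewrite orbT.
  lia.
have uA := subsetP subX _ uX1; have uX := subsetP (subsetDl _ _) _ uA.
have uin : u \in X1 by case/setDP: uX1.
have small : #|Y :\: B| <= s.
  by apply: (missX u) => // [|v vB]; rewrite ?subsetDl // miss ?uin.
have /card_gt0P[v vB] : 0 < #|Y :\: B| by lia.
have vY := subsetP (subsetDl _ _) _ vB.
have lX1 : #|X1 :\: A| <= s.
  apply: (missY v) => // [|w wX1].
    by apply: subset_trans subX (subsetDl _ _).
  apply: miss => //; first exact: (subsetP subX).
  by case/setDP: wX1 => ->.
lia.
Qed.
End AlmostComplete.

(** * Closed walks in the cluster graph *)

Section ClosedWalks.
Variables (L : finType) (h : rel L).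
Hypothesis h_sym : symmetric h.

Lemma cycle_insert s i j : cycle h s -> i \in s -> h i j ->
  exists s', cycle h s' /\ perm_eq s' [:: i, j & s].
Proof.
move=> cs /rot_to[n s1 def_s] hij; exists [:: i, j, i & s1].
split; first by move: cs; rewrite -(rot_cycle n) def_s /= hij h_sym hij.
by rewrite !perm_cons -def_s perm_rot.
Qed.

Lemma cycle_insert_path s i p : cycle h s -> i \in s -> path h i p ->
  exists s', [/\ cycle h s', {subset s <= s'}, {subset p <= s'} &
    size s' = size s + 2 * size p].
Proof.
elim: p s i => [|j p IH] s i cs si /=; first by exists s; split; rewrite ?muln0 ?addn0.
case/andP=> hij pj; have [s1 [c1 p1]] := cycle_insert cs si hij.
have m1 := perm_mem p1.
have [|s2 [c2 sub1 sub2 sz]] := IH s1 j c1 _ pj; first by rewrite m1 !inE eqxx orbT.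
exists s2; split=> //.
- by move=> x xs; apply: sub1; rewrite m1 !inE xs !orbT.
- move=> x; rewrite inE => /predU1P[->|]; last exact: sub2.
  by apply: sub1; rewrite m1 !inE eqxx orbT.
- by rewrite sz (perm_size p1) /=; lia.
Qed.

(** Each target is reached from [i] along a duplicate-free path, of length at most [#|L|], and left
    the same way; going there and back keeps the parity. *)
Lemma cycle_visiting s i ts : cycle h s -> i \in s ->
  {in ts, forall j, connect h i j} ->
  exists s', [/\ cycle h s', {subset s <= s'}, {subset ts <= s'},
    size s' <= size s + 2 * #|L| * size ts & odd (size s') = odd (size s)].
Proof.
elim: ts s => [|j ts IH] s cs si cn; first by exists s; split; rewrite ?muln0 ?addn0.
have [p0 p0p ->] := connectP (cn j (mem_head _ _)).
case/shortenP: p0p => p pp up _.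
have [s1 [c1 sub1 sub2 sz]] := cycle_insert_path cs si pp.
have [|||s2 [c2 sub3 sub4 sz2 od]] := IH s1; rewrite ?sub1 //.
  by move=> k kts; apply: cn; rewrite inE kts orbT.
exists s2; split=> //.
- by move=> x /sub1/sub3.
- move=> x; rewrite inE => /predU1P[->|]; last exact: sub4.
  by apply: sub3; have := mem_last i p; rewrite inE => /predU1P[->|/sub2 //]; apply: sub1.
- have := max_card (mem (i :: p)); rewrite (card_uniqP up) /= mulnS.
  rewrite sz in sz2 => lp; apply: leq_trans sz2 _.
  by rewrite addnA leq_add2r leq_add2l leq_mul2l ltnW.
- by rewrite od sz oddD oddM addbF.
Qed.

Lemma cycle_insert_pairs (V : Type) (f : V -> L) s (ms : seq (V * V)) : cycle h s ->
  all (fun p => (f p.1 \in s) && h (f p.1) (f p.2)) ms ->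
  exists s', cycle h s' /\ perm_eq s' (flatten [seq [:: f p.1; f p.2] | p <- ms] ++ s).
Proof.
move=> cs; elim: ms => [|p ms IH] /=; first by exists s.
case/andP=> /andP[p1 hp] /IH[s1 [c1 e1]].
have [|s2 [c2 e2]] := cycle_insert c1 _ hp.
  by rewrite (perm_mem e1) mem_cat p1 orbT.
by exists s2; split=> //; rewrite (permPl e2) !perm_cons.
Qed.

End ClosedWalks.

(** * Embedding cycles along closed walks *)

Definition take_set (V : finType) (A : {set V}) (k : nat) : {set V} :=
  [set x in take k (enum A)].

Lemma card_take_set (V : finType) (A : {set V}) k : k <= #|A| -> #|take_set A k| = k.
Proof.
move=> kA; rewrite cardsE; have /card_uniqP -> := take_uniq k (enum_uniq A).
by rewrite size_takel // -cardE.
Qed.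

Lemma take_set_sub (V : finType) (A : {set V}) k : take_set A k \subset A.
Proof. by apply/subsetP=> x; rewrite inE => /mem_take; rewrite mem_enum. Qed.

(** Fixes [k i] vertices in every cell [i] at once: the reserve of the embedding, and later the
    slack kept outside the matching. *)
Definition cell_sample (V L : finType) (f : V -> L) (k : L -> nat) : {set V} :=
  [set v | v \in take_set (cell f (f v)) (k (f v))].

Lemma cell_sampleI (V L : finType) (f : V -> L) k i :
  cell f i :&: cell_sample f k = take_set (cell f i) (k i).
Proof.
apply/setP=> v; rewrite in_setI [v \in cell_sample _ _]inE.
apply/andP/idP => [[]|vt]; first by rewrite inE => /eqP ->.
have := subsetP (take_set_sub _ _) _ vt; rewrite inE => /eqP fv.
by split; rewrite ?fv // inE fv.
Qed.

Section Embedding.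
Variables (V L : finType) (f : V -> L) (e : rel V) (a b q : nat).
Hypothesis e_sym : symmetric e.
Hypothesis e_irr : irreflexive e.

Lemma edges_betweenE (X Y : {set V}) :
  edges_between e X Y = \sum_(x in X) #|[set y in Y | e x y]|.
Proof.
rewrite /edges_between -sum1dep_card.
transitivity (\sum_(x in X) \sum_(y in Y | e x y) 1).
  by rewrite pair_big_dep /=; apply: eq_bigl => p; rewrite inE andbA.
by apply: eq_bigr => x _; rewrite sum1dep_card.
Qed.

(** Averaging over [X]: otherwise every vertex of [X] would have fewer than [#|Y| / b] neighbours in
    [Y]. *)
Lemma dense_typical (A B X Y : {set V}) : dense_pair a b e A B ->
  large_in a A X -> large_in a B Y -> 0 < #|A| ->
  exists2 x, x \in X & #|Y| <= b * #|[set y in Y | e x y]|.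
Proof.
move=> /forallP/(_ X)/forallP/(_ Y)/implyP + lX lY A0.
move=> /(_ lX)/implyP/(_ lY); rewrite edges_betweenE => le.
have [x /andP[xX hx]|no] := pickP (fun x => (x \in X) && (#|Y| <= b * #|[set y in Y | e x y]|)).
  by exists x.
have X0 : 0 < #|X| by case/andP: lX => _; case: #|X| => //; rewrite muln0; lia.
have : \sum_(x in X) (b * #|[set y in Y | e x y]|).+1 <= \sum_(x in X) #|Y|.
  by apply: leq_sum => x xX; have := no x; rewrite xX /= ltnNge => ->.
rewrite sum_nat_const; under eq_bigr do rewrite -addn1.
by rewrite big_split /= sum1_card -big_distrr /=; lia.
Qed.

Lemma edges_betweenC (X Y : {set V}) : edges_between e X Y = edges_between e Y X.
Proof.
rewrite /edges_between -(card_imset _ (f := fun p => (p.2, p.1))); last by move=> [? ?] [? ?] [-> ->].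
apply: eq_card => -[y x]; apply/imsetP/idP.
  by case=> -[u v]; rewrite !inE /= => /andP[/andP[uX vY] uv] [-> ->]; rewrite vY uX e_sym.
rewrite !inE /= => /andP[/andP[yY xX] yx]; exists (x, y) => //.
by rewrite !inE /= xX yY e_sym.
Qed.

Lemma dense_pairC A B : dense_pair a b e A B = dense_pair a b e B A.
Proof.
by apply/forallP/forallP => H X; apply/forallP=> Y; have /forallP/(_ X) := H Y;
   rewrite edges_betweenC mulnC; do 2 case: large_in.
Qed.

Let dense i j := dense_pair a b e (cell f i) (cell f j).

Hypothesis b_gt0 : 0 < b.
Hypothesis qb_le_a : q * b <= a.

(** A [1/q] fraction of a cell stays large after the loss of a factor [b], the cost of passing to
    the neighbours of a typical vertex. *)
Let scale_b m k y n : m <= q * k -> k <= y -> y <= b * n -> m <= a * n.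
Proof.
move=> mk ky yn; apply: leq_trans (leq_mul qb_le_a (leqnn n)); rewrite -mulnA.
by apply: leq_trans mk (leq_mul (leqnn q) (leq_trans ky yn)).
Qed.

Let scale m k y : m <= q * k -> k <= y -> m <= a * y.
Proof. by move=> mk ky; apply: scale_b mk ky (leq_pmull y b_gt0). Qed.

(* [D] is a subset of the reserve [R] kept for the last vertex. *)
Lemma greedy_path (r : L -> nat) (R D : {set V}) h w v (U : {set V}) :
  path dense h w -> D \subset R -> [disjoint D & U] ->
  D \subset cell f (last h w) -> large_in a (cell f (last h w)) D ->
  (forall j, j \in h :: w -> #|cell f j| <= q * r j /\
     r j + count_mem j (h :: w) <= #|cell f j :\: (R :|: U)|) ->
  (if w is [::] then exists2 x, x \in D & e v x else
     large_in a (cell f h) [set x in cell f h :\: (R :|: U) | e v x]) ->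
  exists t, [/\ map f t = h :: w, path e v t, uniq t,
    forall x, x \in t -> x \notin U & last v t \in D].
Proof.
elim: w h v U => [|h' w IH] h v U pw DR DU Dl lD cap.
  case=> x xD vx; exists [:: x]; split=> //=.
  - by have := subsetP Dl _ xD; rewrite inE => /eqP ->.
  - by rewrite vx.
  - by move=> y; rewrite inE => /eqP ->; rewrite (disjointFr DU xD).
move=> lC; move: pw => /= /andP[dh pw].
set C := [set x in _ | _] in lC.
have h0 : 0 < #|cell f h|.
  have [_] := cap h (mem_head _ _); rewrite /= eqxx => c1.
  by apply: leq_trans (subset_leq_card (subsetDl _ (R :|: U))); lia.
(* The place of the next vertex: the prescribed set [D] at the last step, otherwise the free
   unreserved part of the next cell. *)
pose Y := if w is [::] then D else cell f h' :\: (R :|: U).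
have [|q' c'] := cap h'; first by rewrite inE mem_head orbT.
have h'0 : 0 < #|cell f h'|.
  apply: leq_trans (subset_leq_card (subsetDl _ (R :|: U))).
  by apply: leq_trans c'; rewrite /= eqxx; lia.
have r' : r h' <= #|cell f h' :\: (R :|: U)| by lia.
have lY : large_in a (cell f h') Y.
  rewrite /Y; case: (w) lD => [//|_ _ _]; rewrite /large_in subsetDl /=; apply: scale q' r'.
have [x xC xY] := dense_typical dh lC lY h0.
have [] : [/\ x \in cell f h, x \notin R, x \notin U & e v x].
  by move: xC; rewrite !inE negb_or => /andP[/andP[/andP[-> ->] ->] ->].
move=> xh xR xU vx.
have nxU : [set y in cell f h' :\: (R :|: (x |: U)) | e x y] =
    [set y in cell f h' :\: (R :|: U) | e x y].
  apply/setP=> y; rewrite !inE; case: (eqVneq y x) => [->|//].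
  by rewrite e_irr !andbF.
have [|||t [ft pt ut nt lt]] := IH h' x (x |: U) pw DR _ Dl lD.
- rewrite disjoint_subset; apply/subsetP=> y yD; rewrite !inE negb_or (disjointFr DU yD) andbT.
  by apply: contra xR => /eqP <-; apply: (subsetP DR).
- move=> j jw; have [|c1 c2] := cap j; first by rewrite inE jw orbT.
  split=> //.
  (* Using [x] costs one place, in cell [h] only, and the multiplicity of [h] in the walk pays for
     it. *)
  have cx : #|cell f j :\: (R :|: U)| <= (h == j) + #|cell f j :\: (R :|: (x |: U))|.
    rewrite (cardsD1 x (cell f j :\: (R :|: U))); apply: leq_add.
      rewrite in_setD [x \in cell f j]inE; move: xh; rewrite inE => /eqP ->.
      by case: (h == j); rewrite ?andbF // leq_b1.
    apply: subset_leq_card; apply/subsetP=> y; rewrite !inE !negb_or.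
    by move=> /andP[-> /andP[/andP[-> ->] ->]].
  rewrite -(leq_add2l (h == j)); apply: leq_trans cx.
  by rewrite addnCA.
- rewrite /Y in lY xY; case: (w) lY xY => [|h'' w'] lY xY; last first.
    apply/andP; split; last by rewrite nxU; apply: scale_b q' r' xY.
    by apply/subsetP=> y; rewrite !inE => /andP[/andP[_ ->]].
  have [y /andP[yD xy]|no] := pickP (fun y => (y \in D) && e x y); first by exists y.
  move: xY; rewrite (_ : [set y in D | _] = set0) ?cards0 ?muln0; last first.
    by apply/setP=> y; have := no y; rewrite !inE.
  rewrite leqn0 => /eqP D0; move: lY; rewrite /large_in D0 muln0 => /andP[_].
  by rewrite leqNgt h'0.
exists (x :: t); split=> //=.
- by rewrite ft; move: xh; rewrite inE => /eqP ->.
- by rewrite vx.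
- by rewrite ut andbT; apply/negP=> /nt; rewrite !inE eqxx.
- move=> y; rewrite inE => /predU1P[->//|/nt]; rewrite !inE negb_or.
  by case/andP.
Qed.

(** The first vertex [v] is chosen with many neighbours both in the reserve of the last cell and
    outside the reserve in the second cell. A greedy path from [v] ending at one of the former
    closes the cycle. *)
Lemma cycle_embedding (r : L -> nat) u0 u1 u2 w :
  let s := [:: u0, u1, u2 & w] in
  1 < a -> cycle (fun i j => dense_pair a b e (cell f i) (cell f j)) s ->
  (forall j, j \in s -> #|cell f j| <= q * r j /\ 2 * r j + count_mem j s <= #|cell f j|) ->
  exists t, [/\ cycle e t, uniq t & map f t = s].
Proof.
move=> s a1 cs cap; set l := last u2 w.
have ls : l \in s by rewrite /s 2!inE mem_last !orbT.
move: cs; rewrite /s /= rcons_path -/l => /and4P[d01 d12 pw dl0].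
have dw : path dense u1 (u2 :: w) by apply/andP; split.
pose R := cell_sample f r.
have cR j : j \in s -> #|cell f j :&: R| = r j.
  by case/cap=> _ c2; rewrite cell_sampleI card_take_set //; lia.
have cDR j : j \in s -> r j + count_mem j s <= #|cell f j :\: R|.
  by move=> js; have [_] := cap j js; have := cardsID R (cell f j); rewrite (cR _ js); lia.
have u0s : u0 \in s by rewrite mem_head.
have u1s : u1 \in s by rewrite !inE eqxx orbT.
have lR : large_in a (cell f l) (cell f l :&: R).
  by rewrite /large_in subsetIl /= cR //; have [c _] := cap l ls; apply: scale c _.
have lR1 : large_in a (cell f u1) (cell f u1 :\: R).
  rewrite /large_in subsetDl /=; have [c _] := cap u1 u1s; apply: scale c _.
  by have := cDR u1 u1s; lia.
have cell_gt0 j : j \in s -> 0 < #|cell f j|.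
  by move=> js; have [_] := cap j js; rewrite -has_pred1 has_count in js; lia.
(* Vertices fit for closing the cycle. If they were not a large set, their complement in the cell
   would be, since [1 < a], against density. *)
pose T := [set x in cell f u0 | #|cell f l :&: R| <= b * #|[set y in cell f l :&: R | e x y]|].
have lT : large_in a (cell f u0) T.
  have TS : T \subset cell f u0 by apply/subsetP=> x; rewrite inE => /andP[].
  rewrite /large_in TS /= leqNgt; apply/negP=> small.
  have [||x] := @dense_typical (cell f u0) (cell f l) (cell f u0 :\: T) _ _ _ lR (cell_gt0 _ u0s).
  - by rewrite dense_pairC.
  - rewrite /large_in subsetDl /=; have := cardsID T (cell f u0).
    rewrite (setIidPr TS); move: small a1; set m := #|T|; set n := #|_ :\: T|.
    move=> small a1 E; rewrite -E in small *.
    have mn : m < n by clear -small a1; nia.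
    by clear -mn a1; nia.
  - by rewrite !inE => /andP[/negP xT x0] le; apply: xT; rewrite x0.
have [v vT v1] := dense_typical d01 lT lR1 (cell_gt0 _ u0s).
move: vT; rewrite !inE => /andP[/eqP fv vl].
pose D := [set y in cell f l :&: R | e v y].
have [||||||t [ft pt ut nt lt]] := @greedy_path r R D u1 (u2 :: w) v [set v] dw.
- by apply/subsetP=> x; rewrite !inE => /andP[/andP[_ ->]].
- by rewrite disjoint_sym disjoints1 !inE e_irr andbF.
- by apply/subsetP=> x; rewrite !inE => /andP[/andP[->]].
- apply/andP; split; first by apply/subsetP=> x; rewrite !inE => /andP[/andP[->]].
  have [c1 _] := cap l ls; move: vl; rewrite -/D cR // => vl.
  by apply: scale_b c1 _ vl.
- move=> j jw; have js : j \in s by rewrite inE jw orbT.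
  have [c1 _] := cap j js; split=> //.
  rewrite -(leq_add2l (u0 == j)) addnCA; apply: leq_trans (cDR j js) _.
  rewrite (cardsD1 v) setDDl leq_add2r in_setD [v \in cell f j]inE fv.
  by case: (u0 == j); rewrite ?andbF // leq_b1.
- rewrite /large_in; have -> : [set x in cell f u1 :\: (R :|: [set v]) | e v x] =
      [set x in cell f u1 :\: R | e v x].
    apply/setP=> y; rewrite !inE; case: (eqVneq y v) => [->|_]; last by rewrite orbF.
    by rewrite e_irr !andbF.
  apply/andP; split; first by apply/subsetP=> y; rewrite !inE => /andP[/andP[_ ->]].
  have [c _] := cap u1 u1s; apply: scale_b c _ v1.
  by have := cDR u1 u1s; lia.
exists (v :: t); split=> //=.
- by rewrite rcons_path pt /= e_sym; move: lt; rewrite !inE => /andP[_ ->].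
- by rewrite ut andbT; apply/negP=> /nt; rewrite inE eqxx.
- by rewrite fv ft.
Qed.
End Embedding.

(** * Monochromatic cycles *)

Lemma min_degree_le (G : sgraph) (x : G) : min_degree G <= degree x.
Proof.
rewrite /min_degree; have : x \in index_enum G by rewrite mem_index_enum.
elim: (index_enum G) => // y s IH; rewrite inE big_cons => /predU1P[->|/IH le].
  exact: geq_minl.
exact: leq_trans (geq_minr _ _) le.
Qed.

Definition color_adj (G : sgraph) (c : two_edge_coloring G) (col : bool) : rel G :=
  fun x y => adj x y && (c [set x; y] == col).

Lemma color_adj_sym (G : sgraph) (c : two_edge_coloring G) col : symmetric (color_adj c col).
Proof. by move=> x y; rewrite /color_adj adj_sym setUC. Qed.

Lemma color_adj_irr (G : sgraph) (c : two_edge_coloring G) col : irreflexive (color_adj c col).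
Proof. by move=> x; rewrite /color_adj adj_irrefl. Qed.

Lemma mono_copy_of_cycle (G : sgraph) (c : two_edge_coloring G) col (t : seq G) :
  cycle (color_adj c col) t -> uniq t -> has_mono_copy (cycle_graph (size t)) c.
Proof.
case: t => [_ _|x p ct ut].
  have f0 : forall i : 'I_0, G by case.
  by exists f0, true; split=> [[]|[]].
set t := x :: p in ut *; exists (fun i : 'I_(size t) => nth x t i), col; split.
  by move=> i j /eqP; rewrite nth_uniq // => /eqP/val_inj.
have step (i : 'I_(size t)) : color_adj c col (nth x t i) (nth x t (ordS i)).
  have /(pathP x)/(_ i) := ct; rewrite size_rcons => /(_ (ltn_ord i)).
  rewrite -rcons_cons nth_rcons ltn_ord nth_rcons /=.
  have := ltn_ord i; rewrite /= ltnS leq_eqVlt => /predU1P[->|lt].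
    by rewrite ltnn eqxx modnn.
  by rewrite lt modn_small.
move=> u v /= /andP[_ /orP[/eqP ->|/eqP ->]]; first by have /andP[-> /eqP] := step u.
by rewrite adj_sym setUC; have /andP[-> /eqP] := step v.
Qed.

Lemma connect_homo (T1 T2 : finType) (e1 : rel T1) (e2 : rel T2) (f : T1 -> T2) u v :
  (forall x y, e1 x y -> e2 (f x) (f y)) -> connect e1 u v -> connect e2 (f u) (f v).
Proof.
move=> hom /connectP[p pp ->]; elim: p u pp => [|w p IH] u /=; first by [].
by case/andP=> /hom/connect1 uw /IH; apply: connect_trans.
Qed.

Lemma card_cell_sample (V L : finType) (f : V -> L) t :
  t * #|cell_sample f (fun i => #|cell f i| %/ t)| <= #|V|.
Proof.
rewrite -[#|V|]mul1n -cardsT; apply: (leq_card_fibers (lab := f)) => i.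
have -> : [set p in cell_sample f (fun i => #|cell f i| %/ t) | f p == i] =
    cell f i :&: cell_sample f (fun i => #|cell f i| %/ t).
  by apply/setP=> v; rewrite !inE andbC.
rewrite cell_sampleI card_take_set ?leq_div // mul1n mulnC.
apply: leq_trans (leq_trunc_div _ _) _; apply: subset_leq_card.
by apply/subsetP=> v; rewrite !inE.
Qed.

Lemma card_small_cells (V L : finType) (f : V -> L) K :
  #|[set v | #|cell f (f v)| < K]| <= #|L| * K.
Proof.
rewrite (card_fibers f) -sum_nat_const; apply: leq_sum => i _.
have [lt|ge] := ltnP #|cell f i| K.
  apply: leq_trans (ltnW lt); apply: subset_leq_card.
  by apply/subsetP=> v; rewrite !inE => /andP[].
rewrite (_ : [set p in _ | _] = set0) ?cards0 //; apply/setP=> v; rewrite !inE.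
by case: eqP => [->|_]; rewrite ?andbF // ltnNge ge.
Qed.

(** Markov's inequality for the number of irregular edges at a vertex. *)
Lemma card_irregular_vertices (C V : finType) (D : {set V * V * C}) t N :
  0 < N -> 16 * t ^ 2 * #|D| <= 16 * N ^ 2 ->
  t * #|[set x | N < t * #|[set p in D | p.1.1 == x]|]| <= N.
Proof.
move=> N0 le; set B := [set x | _]; set m := #|B|.
have : m * N <= t * #|D|.
  rewrite (card_fibers (fun p => p.1.1) D) big_distrr /= /m -sum_nat_const.
  rewrite [leqRHS](bigID (mem B)) /=; apply: leq_trans (leq_addr _ _).
  by apply: leq_sum => x; rewrite inE => /ltnW.
move: #|D| m le => d m le mN; rewrite -(leq_pmul2r N0) -mulnA.
apply: leq_trans (leq_mul (leqnn t) mN) _; rewrite mulnA mulnn mulnn.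
by rewrite -(leq_pmul2l (isT : 0 < 16)) mulnA.
Qed.

(* The label sequence: a bounded closed walk through all cells met by [M],
   then one detour i -> j -> i for each edge of [M] that is still needed. *)
Lemma label_cycle (V L : finType) (f : V -> L) (h : rel L) (M : {set V * V}) n :
  symmetric h -> n <= #|M| -> #|L| ^ 2 < n ->
  (forall p, p \in M -> h (f p.1) (f p.2)) ->
  (forall p q, p \in M -> q \in M -> connect h (f p.1) (f q.1)) ->
  exists (s : seq L) (ms : seq (V * V)),
    [/\ cycle h s, size s = 2 * n, uniq ms, {subset ms <= M} &
     forall j, count_mem j s <=
       count (fun v => f v == j) (map fst ms ++ map snd ms) + 2 * (#|L| ^ 2).+1].
Proof.
move=> h_sym nM Ln hM cM.
have /card_gt0P[p0 p0M] : 0 < #|M| by lia.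
pose ts := enum [set f p.1 | p in M].
have lts : size ts <= #|L| by rewrite -cardE max_card.
(* The initial walk goes back and forth along one matching edge; its length is two, so all later
   lengths are even. *)
have [|||s1 [c1 _ sub1 sz1 od]] := @cycle_visiting _ h h_sym [:: f p0.1; f p0.2] (f p0.1) ts.
- by rewrite /= [h (f p0.2) _]h_sym hM.
- exact: mem_head.
- by move=> j; rewrite mem_enum => /imsetP[p pM ->]; apply: cM.
have sz1' : size s1 <= 2 * (#|L| ^ 2).+1.
  apply: leq_trans sz1 _; rewrite /= mulnS leq_add2l -mulnn -mulnA.
  by rewrite leq_mul2l /= leq_mul2l lts orbT.
have ev : size s1 = 2 * (size s1)./2.
  by rewrite -{1}(odd_double_half (size s1)) od /= add0n -mul2n.
set l := (size s1)./2 in ev.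
have ln : l <= n by lia.
pose ms := take (n - l) (enum M).
have msM : {subset ms <= M} by move=> p /mem_take; rewrite mem_enum.
have sms : size ms = n - l by rewrite size_takel // -cardE; lia.
have [|s2 [c2 e2]] := @cycle_insert_pairs _ h h_sym _ f s1 ms c1.
  apply/allP=> p /msM pM; rewrite hM // andbT.
  by apply: sub1; rewrite mem_enum imset_f.
exists s2, ms; split=> //.
- rewrite (perm_size e2) size_cat.
  have -> : size (flatten [seq [:: f p.1; f p.2] | p <- ms]) = 2 * size ms.
    by elim: (ms) => //= p s ->; rewrite mulnS.
  by rewrite sms ev; lia.
- by rewrite take_uniq ?enum_uniq.
- move=> j; rewrite (permP e2) !count_cat.
  apply: leq_add; last exact: leq_trans (count_size _ _) _.
  by elim: (ms) => //= p s; lia.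
Qed.

(** Integer form with error [1/t]. At most [4 * N / t] vertices are deleted, so both sides keep at
    least [2 * n], and a matching covering half a side has [n] edges. *)
Lemma mono_cycle_nat (t : nat) : 25 <= t -> exists n0, forall n, n0 <= n ->
  forall (G : sgraph) (V1 V2 : {set G}) N,
    bipartition V1 V2 -> #|V1| = N -> #|V2| = N ->
    2 * t * n + 4 * N <= t * N ->
    (forall x : G, 7 * N <= 8 * degree x) ->
  forall c : two_edge_coloring G, has_mono_copy (cycle_graph (2 * n)) c.
Proof.
move=> t25; have t0 : 0 < 8 * t by lia.
(* With two colours and [2 * N] vertices, regularity leaves at most [16 * N ^ 2 / b], that is
   [(N / t) ^ 2], irregular edges. *)
pose b := 16 * t ^ 2; pose q := 4 * t; pose a := q * b.
have [M reg] := regularity bool a b.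
(* A cell of size [K] has room for the [2 * (#|L| ^ 2).+1] extra visits of the connecting walk. The
   choice of [n0] below keeps the smaller cells within [N / t] vertices. *)
pose K := q * (M ^ 2).+2.
exists ((M ^ 2).+2 + t * (M * K)) => n n_ge G V1 V2 N [cov dis ind1 ind2] cV1 cV2 Nn deg c.
have tN : t * (M * K) <= N by nia.
have N0 : 0 < N by nia.
have cG : #|G| = 2 * N.
  by rewrite -cardsT -cov cardsU (disjoint_setI0 dis) cards0 cV1 cV2; lia.
have [L [f [LM irr]]] := reg G (color_adj c).
set D := irregular_edges _ _ _ _ in irr.
pose B := [set x | N < t * #|[set p in D | p.1.1 == x]|].
pose S := [set v | #|cell f (f v)| < K].
pose R := cell_sample f (fun i => #|cell f i| %/ t).
have tB : t * #|B| <= N.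
  apply: card_irregular_vertices => //; apply: leq_trans irr _.
  by rewrite card_bool cG; lia.
have tS : t * #|S| <= N.
  apply: leq_trans tN; rewrite leq_mul2l; apply/orP; right.
  by apply: leq_trans (card_small_cells f K) _; rewrite leq_mul2r LM orbT.
have tR : t * #|R| <= 2 * N by rewrite -cG; apply: card_cell_sample.
pose Z := B :|: S :|: R.
have tZ : t * #|Z| <= 4 * N.
  have l1 := (leq_card_setU (B :|: S) R).1; have l2 := (leq_card_setU B S).1.
  by apply: leq_trans (leq_mul (leqnn t) (leq_trans l1 (leq_add l2 (leqnn _)))) _; lia.
have tD (U : {set G}) : #|U| = N -> t * N <= t * #|U :\: Z| + 4 * N.
  move=> cU; apply: (@leq_trans (t * #|U :\: Z| + t * #|Z|)); last by rewrite leq_add2l.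
  rewrite -mulnDr leq_mul2l; apply/orP; right; rewrite -cU -(cardsID Z U) addnC.
  by rewrite leq_add2l subset_leq_card ?subsetIr.
pose P := minn #|V1 :\: Z| #|V2 :\: Z|.
pose X := take_set (V1 :\: Z) P; pose Y := take_set (V2 :\: Z) P.
have cX : #|X| = P by rewrite card_take_set ?geq_minl.
have cY : #|Y| = P by rewrite card_take_set ?geq_minr.
have tP : t * N <= t * P + 4 * N.
  by rewrite /P; case: (leqP #|V1 :\: Z| #|V2 :\: Z|) => _; apply: tD.
have XV : X \subset V1 :\: Z by apply: take_set_sub.
have YV : Y \subset V2 :\: Z by apply: take_set_sub.
have XY x : x \in X -> x \in Y -> False.
  move=> /(subsetP XV)/setDP[x1 _] /(subsetP YV)/setDP[x2 _].
  by rewrite (disjointFr dis x1) in x2.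
pose dp col i j := dense_pair a b (color_adj c col) (cell f i) (cell f j).
have dp_sym col : symmetric (dp col) by move=> i j; apply/dense_pairC/color_adj_sym.
(* The cluster graph pulled back to vertices, so that a matching may use each cell many times. *)
pose e col u v := ((u \in X) && (v \in Y) || (u \in Y) && (v \in X)) && dp col (f u) (f v).
have e_sym col : symmetric (e col).
  by move=> u v; rewrite /e dp_sym orbC [X in X || _]andbC [X in _ || X]andbC.
(* This is [N / 8 + N / t]: non-neighbours plus irregular edges at a vertex. As [P] is at least
   [N - 4 * N / t], the bound [5 * s < P] amounts to [t > 24]. *)
pose s := (t + 8) * N %/ (8 * t).
have sP : 5 * s < P.
  have : s * (8 * t) <= (t + 8) * N by apply: leq_trunc_div.
  clear -tP t25 N0 => ls; rewrite ltnNge; apply/negP=> Ps; nia.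
have joined (U W X' Y' : {set G}) : #|W| = N -> X' \subset U :\: Z -> Y' \subset W ->
    (forall u v, u \in U -> adj u v -> v \in W) ->
    (forall col u v, u \in X' -> v \in Y' -> dp col (f u) (f v) -> e col u v) ->
    bicolored_joined s e X' Y'.
  move=> cW X'U Y'W UW eX x xX'; have /setDP[xU xZ] := subsetP X'U _ xX'.
  rewrite /s leq_divRL //.
  pose Dx := [set p in D | p.1.1 == x].
  have tDx : t * #|Dx| <= N.
    by move: xZ; rewrite !inE !negb_or => /andP[/andP[+ _] _]; rewrite -leqNgt.
  have non : 8 * #|W :\: [set y | adj x y]| <= N.
    have := cardsID [set y | adj x y] W.
    have -> : W :&: [set y | adj x y] = [set y | adj x y].
      by apply/setIidPr/subsetP=> y; rewrite inE; apply: UW.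
    by rewrite cW; move: (deg x); rewrite /degree; clear; lia.
  have sub : [set v in Y' | ~~ (e true x v || e false x v)] \subset
      (W :\: [set y | adj x y]) :|: [set p.1.2 | p in Dx].
    apply/subsetP=> y; rewrite 3!inE negb_or => /andP[yY' /andP[nt nf]].
    rewrite (subsetP Y'W) // andbT inE; case: (boolP (adj x y)) => //= xy.
    apply/imsetP; exists (x, y, c [set x; y]) => //; rewrite !inE /= eqxx andbT.
    rewrite /color_adj xy eqxx /=; apply/negP=> dd.
    by case: (c _) dd => dd; [have := eX true x y xX' yY' dd | have := eX false x y xX' yY' dd];
       rewrite ?(negbTE nt) ?(negbTE nf).
  have := leq_trans (subset_leq_card sub) (leq_card_setU _ _).1.
  have := leq_imset_card (fun p => p.1.2) (mem Dx).
  move: non tDx; set n1 := #|_ :\: _|; set n2 := #|Dx|; set n3 := #|[set _ | _ in _]|.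
  move: #|_| => n4 h1 h2 h3 h4; clear -h1 h2 h3 h4 t25.
  have : n4 * (8 * t) <= (n1 + n2) * (8 * t) by rewrite leq_mul2r; lia.
  nia.
have adjV u v : adj u v -> (u \in V1 -> v \in V2) /\ (u \in V2 -> v \in V1).
  have vin : v \in V1 :|: V2 by rewrite cov inE.
  move=> uv; split=> uV; move: vin; rewrite inE => /orP[] // vV.
    by have := ind1 u v uV vV; rewrite uv.
  by have := ind2 u v uV vV; rewrite uv.
have jXY : bicolored_joined s e X Y.
  apply: (joined V1 V2) => //; first exact: subset_trans YV (subsetDl _ _).
    by move=> u v + uv; case: (adjV u v uv).
  by move=> col u v uX vY d; rewrite /e uX vY d.
have jYX : bicolored_joined s e Y X.
  apply: (joined V2 V1) => //; first exact: subset_trans XV (subsetDl _ _).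
    by move=> u v + uv; case: (adjV u v uv).
  by move=> col u v uX vY d; rewrite /e uX vY d orbT.
have [col [Mt [[inj1 inj2] MtE lMt conn]]] := connected_matching e_sym cX cY sP jXY jYX.
pose h i j := [&& dp col i j, K <= #|cell f i| & K <= #|cell f j|].
have h_sym : symmetric h by move=> i j; rewrite /h dp_sym [X in _ && X]andbC.
have big v : v \notin Z -> K <= #|cell f (f v)|.
  by rewrite !inE !negb_or => /andP[/andP[_ +] _]; rewrite -leqNgt.
have XZ x : x \in X -> x \notin Z by move=> /(subsetP XV)/setDP[].
have YZ y : y \in Y -> y \notin Z by move=> /(subsetP YV)/setDP[].
have bigX x : x \in X -> K <= #|cell f (f x)| by move/XZ/big.
have bigY y : y \in Y -> K <= #|cell f (f y)| by move/YZ/big.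
have eh u v : e col u v -> h (f u) (f v).
  by case/andP=> /orP[] /andP[u1 v1] d; apply/and3P; split=> //; do [exact: bigX | exact: bigY].
have L2 : #|L| ^ 2 <= M ^ 2 by rewrite leq_exp2r.
have nMt : n <= #|Mt| by clear -Nn tP lMt t25; nia.
have ltLn : #|L| ^ 2 < n.
  by apply: leq_ltn_trans L2 _; apply: leq_trans n_ge; rewrite addSn ltnS leqW // leq_addr.
have [||S0 [ms [cs szs ums msM cnt]]] := @label_cycle _ _ f h Mt n h_sym nMt ltLn.
- by move=> p /MtE/and3P[_ _ /eh].
- by move=> p p' pM p'M; apply: connect_homo (eh) (conn _ _ pM p'M).
pose vs := map fst ms ++ map snd ms.
have uvs : uniq vs.
  rewrite cat_uniq; apply/and3P; split.
  - by rewrite map_inj_in_uniq // => p p' /msM pM /msM p'M; apply: inj1.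
  - apply/hasPn=> y /mapP[p /msM/MtE/and3P[_ pY _] ->]; apply/negP.
    by case/mapP=> p' /msM/MtE/and3P[pX _ _] E; apply: (XY p.2) => //; rewrite E.
  - by rewrite map_inj_in_uniq // => p p' /msM pM /msM p'M; apply: inj2.
have vsR v : v \in vs -> v \notin R.
  have ZR u : u \notin Z -> u \notin R by rewrite in_setU negb_or => /andP[].
  by rewrite mem_cat => /orP[] /mapP[p /msM/MtE/and3P[/XZ/ZR ? /YZ/ZR ? _] ->].
pose r j := (#|cell f j| %/ q).+1.
(* Matching vertices avoid [R], so [#|cell f j| %/ t] places stay free, at least four times
   [#|cell f j| %/ q]. Half of this pays for [2 * r j] up to rounding, the rest for the rounding and
   the connecting walk. *)
have cap j : j \in S0 -> #|cell f j| <= q * r j /\ 2 * r j + count_mem j S0 <= #|cell f j|.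
  move=> js; have q0 : 0 < q by rewrite /q; clear -t25; lia.
  have /and3P[_ Kj _] := next_cycle cs js; split; first by rewrite mulnC ltnW // ltn_ceil.
  have c1 : count (fun v => f v == j) vs <= #|cell f j :\: R|.
    rewrite -size_filter -(card_uniqP (filter_uniq _ uvs)); apply: subset_leq_card.
    by apply/subsetP=> v; rewrite mem_filter inE => /andP[fv /vsR ->]; rewrite inE.
  have c2 : #|cell f j :&: R| = #|cell f j| %/ t.
    by rewrite cell_sampleI card_take_set ?leq_div.
  have c3 := cardsID R (cell f j); rewrite c2 in c3.
  have c4 := leq_trans (cnt j) (leq_add c1 (leqnn _)).
  have c5 : (#|cell f j| %/ q) * 4 <= #|cell f j| %/ t.
    rewrite leq_divRL; last by clear -t25; lia.
    by rewrite -mulnA -/q; apply: leq_trunc_div.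
  have c6 : (M ^ 2).+2 <= #|cell f j| %/ q by rewrite leq_divRL // mulnC.
  by rewrite /r; clear -c3 c4 c5 c6 L2; lia.
have n2 : 2 <= n by apply: leq_trans n_ge; rewrite addSn.
case: S0 cs szs cnt cap => [|u0 [|u1 [|u2 w]]] cs szs cnt cap; try by move: szs n2 => /=; clear; lia.
have b0 : 0 < b by rewrite /b muln_gt0 expn_gt0; clear -t25; lia.
have a1 : 1 < a by rewrite /a /q; clear -t25 b0; nia.
have cs' : cycle (fun i j => dp col i j) [:: u0, u1, u2 & w].
  by apply: sub_cycle cs => i j /andP[].
have [T [cT uT fT]] := @cycle_embedding _ _ f (color_adj c col) a b q
  (color_adj_sym c col) (@color_adj_irr _ c col) b0 (leqnn _) r u0 u1 u2 w a1 cs' cap.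
have := mono_copy_of_cycle cT uT.
by rewrite -(size_map f) fT szs.
Qed.

(** * Passage from the integer form to the real parameter *)

Local Open Scope ring_scope.

Theorem theorem1p5 (R : realType) (xi : R) (hxi : 0 < xi) :
  exists n0 : nat, forall n : nat, (n0 <= n)%N ->
  forall (G : sgraph) (V1 V2 : {set G}) (N : nat),
    bipartition V1 V2 ->
    #|V1| = N -> #|V2| = N -> N%:R = (2 + 8 * xi) * n%:R ->
    (7 / 8 + 9 * xi) * N%:R < (min_degree G)%:R ->
  forall c : two_edge_coloring G, has_mono_copy (cycle_graph (2 * n)) c.
Proof.
(* As [N] is [(2 + 8 * xi) * n], the size condition of [mono_cycle_nat] reduces to
   [1 + 4 * xi <= t * xi]. *)
pose t := (25 + Num.bound ((1 + 4 * xi) / xi))%N.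
have tx : 1 + 4 * xi <= t%:R * xi.
  rewrite -ler_pdivrMr // natrD; apply: ltW; apply: lt_le_trans (archi_boundP _) _.
    by rewrite divr_ge0 ?ltW // addr_gt0 ?mulr_gt0.
  by rewrite lerDr.
have [n0 H] := mono_cycle_nat (leq_addr _ _ : (25 <= t)%N).
exists n0 => n n_ge G V1 V2 N bip c1 c2 NE deg c.
apply: (H n n_ge G V1 V2 N bip c1 c2).
  rewrite -(ler_nat R) natrD !natrM NE.
  have -> : t%:R * ((2 + 8 * xi) * n%:R) =
      2 * t%:R * n%:R + 8 * (t%:R * xi) * n%:R by ring.
  rewrite lerD2l [X in X <= _]mulrA; apply: ler_wpM2r; first exact: ler0n.
  lra.
move=> x; rewrite -(ler_nat R) !natrM.
have : (min_degree G)%:R <= (degree x)%:R :> R by rewrite ler_nat min_degree_le.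
have : 0 <= xi * N%:R by rewrite mulr_ge0 ?ler0n ?ltW.
lra.
Qed.
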